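(* Let $Q\subseteq\mathbb{R}^n$ be a convex compact set, let $f$ be a convex function with a minimizer $x_*$ over $Q$, and let $\psi_\delta$ be a $(\delta,L,\mu)$-model of $f$ with respect to $V$ at every point $y\in Q$ ($\delta,L,\mu>0$). Let $\widetilde\delta>0$, $x^0\in Q$, and $2\mu\le L_0\le 2L$. Let $(x^k)_{k\ge0}$ and $(L_k)_{k\ge 0}$ be generated by the adaptive gradient method described in the context. For $k\ge0$ define $\hat L=\hat L(k)$ by $$1-\frac{\mu}{\hat L}=\sqrt[k+1]{\Bigl(1-\frac{\mu}{L_{k+1}}\Bigr)\Bigl(1-\frac{\mu}{L_k}\Bigr)\cdots\Bigl(1-\frac{\mu}{L_1}\Bigr)} .$$ Then for every $k\ge 0$ $$V[x^{k+1}](x_* )\le\frac{2L(\delta+\widetilde\delta)}{\mu^2}\Bigl(1-\Bigl(1-\frac{\mu}{2L}\Bigr)^{k+1}\Bigr)+\Bigl(1-\frac{\mu}{\hat L}\Bigr)^{k+1}V[x^0](x_* )$$ and $$f(x^{k+1})-f(x_* )\le\frac{4L^2(\delta+\widetilde\delta)}{\mu^2}\Bigl(1-\Bigl(1-\frac{\mu}{2L}\Bigr)^{k+1}\Bigr)+2L\Bigl(1-\frac{\mu}{\hat L}\Bigr)^{k+1}V[x^0](x_* ).$$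
   Context: Prox-function and Bregman divergence: $d:\mathbb{R}^n\to\mathbb{R}$ is continuous, convex and differentiable (not necessarily strongly convex) with $\min_{x\in\mathbb{R}^n} d(x)=0$, and $V[y](x):=d(x)-d(y)-\langle\nabla d(y),x-y\rangle$. $(\delta,L,\mu)$-model: a function $\psi_\delta(x,y)$, convex in $x\in Q$ with $\psi_\delta(x,x)=0$ for all $x\in Q$, is a $(\delta,L,\mu)$-model of $f$ at $y$ with respect to $V$ if for all $x\in Q$ $$\mu V[y](x)\le f(x)-\bigl(f(y)+\psi_\delta(x,y)\bigr)\le L V[y](x)+\delta .$$ Inexact minimization: for a convex function $\phi$ on $Q$, the notation $\tilde x={\arg\min_{x\in Q}}^{\widetilde\delta}\phi(x)$ means that $\tilde x\in Q$ satisfies: if $\phi$ is smooth, $\max_{x\in Q}\langle\nabla\phi(\tilde x),\tilde x-x\rangle\le\widetilde\delta$; if $\phi$ is a general convex function, there exists $h\in\partial\phi(\tilde x)$ with $\langle h,x_*-\tilde x\rangle\ge-\widetilde\delta$, where $x_*$ is the fixed minimizer of $f$ on $Q$. Adaptive gradient method: given $x^0$, $\mu$, $L_0\ge 2\mu$, $\delta$, $\widetilde\delta$, for $k=0,1,2,\dots$ find the smallest integer $i_k\ge0$ such that, with $L_{k+1}=2^{i_k-1}L_k$ if $L_k\ge2\mu$ and $L_{k+1}=2^{i_k}L_k$ if $L_k<2\mu$, and $$x^{k+1}:={\arg\min_{x\in Q}}^{\widetilde\delta}\bigl\{\psi_\delta(x,x^k)+L_{k+1}V[x^k](x)\bigr\},$$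 one has $$f(x^{k+1})\le f(x^k)+\psi_\delta(x^{k+1},x^k)+L_{k+1}V[x^k](x^{k+1})+\delta .$$ *)

(* Defs.v *)
From HB Require Import structures.
From mathcomp Require Import all_boot all_order all_algebra.
From mathcomp Require Import all_classical all_reals all_analysis.

Set Implicit Arguments.
Unset Strict Implicit.
Unset Printing Implicit Defensive.

Import Order.TTheory GRing.Theory Num.Theory.
Import numFieldNormedType.Exports.

Local Open Scope classical_set_scope.
Local Open Scope ring_scope.

Section Euclidean.
Context {R : realType} {n : nat}.
Implicit Types (Q : set 'rV[R]_n) (phi d f : 'rV[R]_n -> R).

Definition inner (u v : 'rV[R]_n) : R := \sum_(i < n) u 0 i * v 0 i.

Definition grad phi (y : 'rV[R]_n) : 'rV[R]_n :=
  \row_(i < n) 'D_(delta_mx 0 i) phi y.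

Definition is_minimizer f Q (xs : 'rV[R]_n) : Prop :=
  Q xs /\ forall x, Q x -> f xs <= f x.

(* phi is regarded as a function on Q, so only the values of phi on Q occur
   in the subgradient inequality. *)
Definition subdifferential Q phi (x : 'rV[R]_n) : set 'rV[R]_n :=
  [set h | forall z, Q z -> phi x + inner h (z - x) <= phi z].

Definition smooth_on Q phi : Prop := forall x, Q x -> differentiable phi x.

(* The last two conjuncts say that the minimum of d is attained and is 0. *)
Definition prox_function d : Prop :=
  [/\ continuous d,
      convex_function setT d,
      forall x, differentiable d x,
      exists x, d x = 0
    & forall x, 0 <= d x].

(* bregman d y x is V[y](x): the base point comes first. *)
Definition bregman d (y x : 'rV[R]_n) : R :=
  d x - d y - inner (grad d y) (x - y).

Definition is_model (V : 'rV[R]_n -> 'rV[R]_n -> R) Q f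
    (psi : 'rV[R]_n -> 'rV[R]_n -> R) (delta L mu : R) (y : 'rV[R]_n) : Prop :=
  [/\ convex_function Q (fun x => psi x y),
      forall x, Q x -> psi x x = 0
    & forall x, Q x ->
        mu * V y x <= f x - (f y + psi x y) <= L * V y x + delta].

(* xs is the fixed minimizer of the objective over Q, not a minimizer of phi. *)
Definition inexact_argmin Q (xs : 'rV[R]_n) (tdelta : R) phi
    (xt : 'rV[R]_n) : Prop :=
  [/\ Q xt,
      smooth_on Q phi ->
        forall x, Q x -> inner (grad phi xt) (xt - x) <= tdelta
    & ~ smooth_on Q phi ->
        exists2 h, subdifferential Q phi xt h & - tdelta <= inner h (xs - xt)].

Definition trial_const (mu Lk : R) (i : nat) : R :=
  if 2 * mu <= Lk then 2 ^ (i%:Z - 1) * Lk else 2 ^ i%:Z * Lk.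

Definition descent_test (V : 'rV[R]_n -> 'rV[R]_n -> R) f
    (psi : 'rV[R]_n -> 'rV[R]_n -> R) (delta : R) (xk : 'rV[R]_n) (M : R)
    (z : 'rV[R]_n) : Prop :=
  f z <= f xk + psi z xk + M * V xk z + delta.

(* An inexact minimizer is not unique, so a run of the method computes one
   candidate c j for each trial index j; the accepted index i is the smallest
   one whose candidate passes the test. *)
Definition adaptive_step (V : 'rV[R]_n -> 'rV[R]_n -> R) Q f
    (psi : 'rV[R]_n -> 'rV[R]_n -> R) (xs : 'rV[R]_n) (mu delta tdelta : R)
    (xk : 'rV[R]_n) (Lk : R) (xk1 : 'rV[R]_n) (Lk1 : R) : Prop :=
  exists (i : nat) (c : nat -> 'rV[R]_n),
    [/\ forall j, (j <= i)%N ->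
          inexact_argmin Q xs tdelta
            (fun x => psi x xk + trial_const mu Lk j * V xk x) (c j),
        forall j, (j < i)%N ->
          ~ descent_test V f psi delta xk (trial_const mu Lk j) (c j),
        descent_test V f psi delta xk (trial_const mu Lk i) (c i),
        Lk1 = trial_const mu Lk i
      & xk1 = c i].

Definition adaptive_gradient_run (V : 'rV[R]_n -> 'rV[R]_n -> R) Q f
    (psi : 'rV[R]_n -> 'rV[R]_n -> R) (xs : 'rV[R]_n) (mu delta tdelta : R)
    (x0 : 'rV[R]_n) (L0 : R) (x : nat -> 'rV[R]_n) (Ls : nat -> R) : Prop :=
  [/\ x 0%N = x0,
      Ls 0%N = L0
    & forall k, adaptive_step V Q f psi xs mu delta tdelta
                  (x k) (Ls k) (x k.+1) (Ls k.+1)].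

End Euclidean.

(* Main.v *)
Require Import Defs.
From mathcomp Require Import all_boot all_order all_algebra.
From mathcomp Require Import all_classical all_reals all_analysis.
From mathcomp Require Import ring lra.

(** The estimate is that of gradient descent under relative strong convexity:
    one inequality per iteration, then a contracting scalar recursion.

    At an inexact minimizer [x'] of [psi(., y) + M V[y]], first-order optimality
    up to [tdelta], convexity of [psi(., y)] and the three-point identity for
    Bregman divergences ([inexact_argmin_gap]) give
    [psi(x', y) + M V[y](x') + M V[x'](xs) <= psi(xs, y) + M V[y](xs) + tdelta].
    The acceptance test bounds [f x'] by the first two terms on the left plus
    [f y + delta], and the lower half of the model bounds [psi(xs, y)] by
    [f xs - f y - mu V[y](xs)].  Hence ([adaptive_step_descent])
    [M V[x'](xs) + (f x' - f xs) <= (M - mu) V[y](xs) + delta + tdelta].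
    The upper half of the model makes every trial constant [M >= L] pass the
    test, so the accepted constants never exceed [2 L]; they never drop below
    [mu] by the rule that halves only when [L_k >= 2 mu]
    ([adaptive_step_const_bounds]).

    Put [D = delta + tdelta], [V_k = V[x_k](xs)] and
    [W_k = (1 - mu / L_{k+1}) V_k + D / L_{k+1}].  Each of the two nonnegative
    terms on the left of the step inequality is at most the right-hand side, so
    [V_{k+1} <= W_k] and [f x_{k+1} - f xs <= L_{k+1} W_k <= 2 L W_k].  The
    noise in the recursion telescopes: with [P] the product of the
    [1 - mu / L_i], it contributes exactly [D / mu * (1 - P)]
    ([contraction_unroll]).

    Since [L_i <= 2 L], replacing [P] by [(1 - mu / (2 L)) ^ (k + 1)] in
    [1 - P] goes in the wrong direction; the extra factor [2 L / mu] in the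
    stated bound pays for it, because
    [1 - P <= 1 = 2 L / mu * (1 - (1 - mu / (2 L)))] and a higher power of
    [1 - mu / (2 L)] only increases the last factor. *)

Set Implicit Arguments.
Unset Strict Implicit.

Import Order.TTheory GRing.Theory Num.Theory.
Import numFieldNormedType.Exports.

Local Open Scope classical_set_scope.
Local Open Scope ring_scope.

(** * Inner product, gradient and Bregman divergence *)

Section Inner.
Context {R : realType} {n : nat}.
Implicit Types u v w : 'rV[R]_n.

Lemma innerDr u v w : inner u (v + w) = inner u v + inner u w.
Proof.
rewrite /inner -big_split /=; apply: eq_bigr => i _.
by rewrite mxE mulrDr.
Qed.

Lemma innerZr u (c : R) v : inner u (c *: v) = c * inner u v.
Proof.
rewrite /inner mulr_sumr; apply: eq_bigr => i _.
by rewrite mxE mulrCA.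
Qed.

Lemma innerNr u v : inner u (- v) = - inner u v.
Proof. by rewrite -scaleN1r innerZr mulN1r. Qed.

Lemma innerBr u v w : inner u (v - w) = inner u v - inner u w.
Proof. by rewrite innerDr innerNr. Qed.

Lemma derive_grad (phi : 'rV[R]_n -> R) y v :
  differentiable phi y -> 'D_v phi y = inner (grad phi y) v.
Proof.
move=> dphi; rewrite deriveE // [v in LHS]row_sum_delta linear_sum.
apply: eq_bigr => i _; rewrite linearZ /= mxE deriveE //.
by rewrite mulrC.
Qed.

Lemma bregman_three_point (d : 'rV[R]_n -> R) u v w :
  inner (grad d v) (w - v) - inner (grad d u) (w - v)
  = bregman d u w - bregman d v w - bregman d u v.
Proof. by rewrite /bregman !innerBr; ring. Qed.

End Inner.

(** * Convexity along segments *)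

(** The bound is asked only for steps in [(0, 1]], since a convex domain
    contains no more of the ray; the two-sided limit that defines the derivative
    is read along positive steps. *)
Lemma derive_le_slope (R : realType) (V : normedModType R) (q : V -> R)
    (a v : V) (B : R) :
  derivable q a v ->
  (forall t : R, 0 < t <= 1 -> q (t *: v + a) - q a <= t * B) ->
  'D_v q a <= B.
Proof.
move=> dq slope.
have lim_right : (fun t : R => t^-1 *: (q (t *: v + a) - q a)) @ 0^'+
    --> 'D_v q a.
  exact: cvg_dnbhs_at_right.
apply: (cvgr_to_le lim_right).
near=> t.
have t0 : 0 < t by near: t; exact: nbhs_right_gt.
rewrite /= ler_pdivrMl // slope // t0 /=.
by near: t; exact: nbhs_right_le.
Unshelve. all: by end_near. Qed.

Section Convexity.
Context {R : realType} {n : nat}.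
Implicit Types (Q : set 'rV[R]_n) (d p : 'rV[R]_n -> R).

Let segmentE (a z : 'rV[R]_n) (t : R) :
  t *: (z - a) + a = t *: z + (1 - t) *: a.
Proof. by rewrite scalerBr scalerBl scale1r addrAC addrA. Qed.

Lemma convex_set_segment Q (a z : 'rV[R]_n) (t : R) :
  convex_set Q -> Q a -> Q z -> 0 <= t <= 1 -> Q (t *: (z - a) + a).
Proof.
move=> Qc Qa Qz /andP[t0 t1].
have := set_mem (Qc z a (Itv01 t0 t1) (mem_set Qz) (mem_set Qa)).
by rewrite segmentE.
Qed.

Lemma convex_function_segment Q p (a z : 'rV[R]_n) (t : R) :
  convex_function Q p -> Q a -> Q z -> 0 <= t <= 1 ->
  p (t *: (z - a) + a) - p a <= t * (p z - p a).
Proof.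
move=> pc Qa Qz /andP[t0 t1].
have : p (t *: z + (1 - t) *: a) <= t * p z + (1 - t) * p a.
  exact: (pc (Itv01 t0 t1) z a (mem_set Qz) (mem_set Qa)).
by rewrite segmentE; lra.
Qed.

(** The gradient inequality of the convex function [d]: its slopes along the
    segment from [y] to [x] are all at most [d x - d y], and so is their limit. *)
Lemma bregman_ge0 d (y x : 'rV[R]_n) :
  convex_function setT d -> differentiable d y -> 0 <= bregman d y x.
Proof.
move=> dc dd.
suff : inner (grad d y) (x - y) <= d x - d y by rewrite /bregman; lra.
rewrite -derive_grad //; apply: derive_le_slope; first exact: diff_derivable.
move=> t /andP[t0 t1].
by apply: (@convex_function_segment setT) => //; rewrite (ltW t0).
Qed.

Lemma bregman_shift d (y a v : 'rV[R]_n) (t : R) :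
  bregman d y (t *: v + a) - bregman d y a
  = d (t *: v + a) - d a - t * inner (grad d y) v.
Proof. by rewrite /bregman !innerBr innerDr innerZr; ring. Qed.

(** * One step of the method *)

(** Both forms of inexact optimality say that the slopes of [phi] at [xt]
    towards [xs] are at least [- tdelta] in the limit, whereas convexity of [p]
    bounds the slopes of [phi] minus its Bregman part by [p xs - p xt].  The
    derivative of [M d] at [xt] is therefore enough to compare the two, and [p]
    is never differentiated on its own: in the smooth case the derivable function is
    [phi - M d], in the other case it is [- M d], with the subgradient [h]
    supplying a lower bound for the increments of [phi]. *)
Lemma inexact_argmin_gap Q d p (y xt xs : 'rV[R]_n) (M tdelta : R) :
  convex_set Q -> convex_function Q p -> (forall x, differentiable d x) ->
  Q xs ->
  inexact_argmin Q xs tdelta (fun x => p x + M * bregman d y x) xt ->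
  p xt + M * bregman d y xt + M * bregman d xt xs
  <= p xs + M * bregman d y xs + tdelta.
Proof.
set phi := (fun x => _) => Qc pc dd Qxs [Qxt smooth nonsmooth].
set v := xs - xt.
suff : M * inner (grad d y) v - tdelta - M * inner (grad d xt) v <= p xs - p xt.
  have := bregman_three_point d y xt xs.
  by rewrite -/v => /(congr1 ( *%R M)); lra.
have Dd : is_derive xt v d (inner (grad d xt) v).
  by apply: DeriveDef; [exact: diff_derivable | exact: derive_grad].
have [phi_smooth|phi_rough] := pselect (smooth_on Q phi).
  have opt : - tdelta <= inner (grad phi xt) v.
    by have := smooth phi_smooth xs Qxs; rewrite -opprB innerNr -/v; lra.
  have Dphi : is_derive xt v phi (inner (grad phi xt) v).
    apply: DeriveDef; first exact/diff_derivable/phi_smooth.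
    exact/derive_grad/phi_smooth.
  pose q x := phi x - M * d x.
  have Dq : is_derive xt v q
      (inner (grad phi xt) v - M * inner (grad d xt) v) by exact: is_deriveB.
  suff : 'D_v q xt <= p xs - p xt - M * inner (grad d y) v.
    by rewrite derive_val; lra.
  apply: derive_le_slope; first exact: ex_derive.
  move=> t /andP[t0 t1].
  have t01 : 0 <= t <= 1 by rewrite (ltW t0).
  have := convex_function_segment pc Qxt Qxs t01.
  have := bregman_shift d y xt v t => /(congr1 ( *%R M)).
  by rewrite -/v /q /phi; lra.
(* Adding the subgradient inequality at the intermediate point to convexity of
   [p] removes [phi], leaving only increments of [d]. *)
have [h h_sub h_opt] := nonsmooth phi_rough.
pose q x := - (M * d x).
have Dq : is_derive xt v q (- (M * inner (grad d xt) v)) by exact: is_deriveN.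
suff : 'D_v q xt <= p xs - p xt - M * inner (grad d y) v - inner h v.
  by rewrite derive_val; move: h_opt; rewrite -/v; lra.
apply: derive_le_slope; first exact: ex_derive.
move=> t /andP[t0 t1].
have t01 : 0 <= t <= 1 by rewrite (ltW t0).
have := convex_function_segment pc Qxt Qxs t01.
have := h_sub _ (convex_set_segment Qc Qxt Qxs t01).
have := bregman_shift d y xt v t => /(congr1 ( *%R M)).
by rewrite addrK innerZr -/v /q /phi; lra.
Qed.

End Convexity.

Section TrialConstants.
Context {R : realType} (mu Lk : R).

Lemma trial_const0 :
  trial_const mu Lk 0 = if 2 * mu <= Lk then Lk / 2 else Lk.
Proof.
by rewrite /trial_const expr0z mul1r; case: ifP => // _; exact: mulrC.
Qed.

Lemma trial_constS j : trial_const mu Lk j.+1 = 2 * trial_const mu Lk j.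
Proof.
have twoS (m : int) : (2 : R) ^ (1 + m) = 2 * 2 ^ m by rewrite expfzDr ?expr1z.
by rewrite /trial_const intS -addrA !twoS; case: ifP; rewrite mulrA.
Qed.

(** Halving happens only from [2 mu] upwards. *)
Lemma trial_const_ge j : 0 < mu -> mu <= Lk -> mu <= trial_const mu Lk j.
Proof.
move=> mu0 muL; elim: j => [|j IHj]; last by rewrite trial_constS; lra.
by rewrite trial_const0; case: ifP => //; lra.
Qed.

End TrialConstants.

Section AdaptiveStep.
Context {R : realType} {n : nat}.
Context (d f : 'rV[R]_n -> R) (psi : 'rV[R]_n -> 'rV[R]_n -> R).
Context (Q : set 'rV[R]_n) (xs xk xk1 : 'rV[R]_n).
Context (delta L mu tdelta Lk Lk1 : R).
Context (d_prox : prox_function d).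
Context (model : is_model (bregman d) Q f psi delta L mu xk).
Context (step : adaptive_step (bregman d) Q f psi xs mu delta tdelta
  xk Lk xk1 Lk1).

Lemma adaptive_step_mem : Q xk1.
Proof. by case: step => i [c [cand _ _ _ ->]]; case: (cand i (leqnn i)). Qed.

(** The test with constant [L] is the upper bound of the model, and it weakens
    as the constant grows because the divergence is nonnegative. *)
Lemma model_descent_test M z :
  L <= M -> Q z -> descent_test (bregman d) f psi delta xk M z.
Proof.
move=> LM Qz; case: model => _ _ /(_ z Qz) /andP[_ upper].
have V0 : 0 <= bregman d xk z.
  by case: d_prox => _ dc dd _ _; exact: bregman_ge0.
have : L * bregman d xk z <= M * bregman d xk z by rewrite ler_wpM2r.
by rewrite /descent_test; lra.
Qed.

(** A constant accepted after a rejection is twice a rejected one, and rejected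
    constants are below [L]. *)
Lemma adaptive_step_const_bounds :
  0 < mu -> mu <= Lk <= 2 * L -> mu <= Lk1 <= 2 * L.
Proof.
move=> mu0 /andP[muL LkL]; case: step => i [c [cand reject _ -> _]].
rewrite trial_const_ge //=.
case: i cand reject => [|i] cand reject.
  by rewrite trial_const0; case: ifP => _; lra.
have [|LM] := ltP (trial_const mu Lk i) L.
  by rewrite trial_constS; lra.
have [Qci _ _] := cand i (leqnSn i).
by case: (reject i (ltnSn i)); exact: model_descent_test.
Qed.

(** The step inequality, with the term [mu V[xk](xs)] gained from the lower
    bound of the model at [xs]. *)
Lemma adaptive_step_descent :
  convex_set Q -> Q xs ->
  Lk1 * bregman d xk1 xs + f xk1
  <= (Lk1 - mu) * bregman d xk xs + f xs + (delta + tdelta).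
Proof.
move=> Qc Qxs; case: step => i [c [cand _ accept -> ->]].
case: model => psi_cvx _ /(_ xs Qxs) /andP[lower _].
case: d_prox => _ _ dd _ _.
have := inexact_argmin_gap Qc psi_cvx dd Qxs (cand i (leqnn i)).
by move: accept; rewrite /descent_test; lra.
Qed.

End AdaptiveStep.

(** * The scalar recursion *)

(** The fixed point of [v |-> (1 - mu / l) * v + D / l] is [D / mu] whatever
    [l] is, so every step contracts the distance to it by exactly
    [1 - mu / l].  The conclusion is about the right-hand side of the recursion
    at [k] rather than about [V k.+1], because the objective gap is controlled
    by this right-hand side and not by [V k.+1]. *)
Lemma contraction_unroll (R : realType) (mu D : R) (Ls V : nat -> R) :
  0 < mu -> (forall k, mu <= Ls k.+1) ->
  (forall k, V k.+1 <= (1 - mu / Ls k.+1) * V k + D / Ls k.+1) ->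
  forall k, let P := \prod_(1 <= i < k.+2) (1 - mu / Ls i) in
  0 <= P <= 1 /\
  (1 - mu / Ls k.+1) * V k + D / Ls k.+1 <= P * V 0%N + D / mu * (1 - P).
Proof.
move=> mu0 muL rec k P; rewrite {}/P.
have Lpos j : 0 < Ls j.+1 by rewrite (lt_le_trans mu0).
have ratio j : 0 <= 1 - mu / Ls j.+1 <= 1.
  apply/andP; split; last by rewrite gerBl divr_ge0 ?ltW.
  by rewrite subr_ge0 ler_pdivrMr // mul1r.
elim: k => [|k [/andP[P0 P1] IHk]].
  rewrite big_nat1; split; first exact: ratio.
  rewrite lerD2l [leLHS](_ : _ = D / mu * (1 - (1 - mu / Ls 1%N))) //.
  by field; rewrite !gt_eqF.
rewrite big_nat_recr //=.
set P := \prod_(1 <= i < k.+2) _ in P0 P1 IHk *.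
have /andP[r0 r1] := ratio k.+1.
split; first by rewrite mulr_ge0 //= mulr_ile1.
have -> : P * (1 - mu / Ls k.+2) * V 0%N
    + D / mu * (1 - P * (1 - mu / Ls k.+2))
  = (1 - mu / Ls k.+2) * (P * V 0%N + D / mu * (1 - P)) + D / Ls k.+2.
  by field; rewrite !gt_eqF.
by rewrite lerD2r ler_wpM2l // (le_trans (rec k)).
Qed.

Unset Implicit Arguments.

Theorem theorem2 (R : realType) (n : nat)
    (d : 'rV[R]_n -> R) (Q : set 'rV[R]_n) (f : 'rV[R]_n -> R)
    (xs : 'rV[R]_n) (psi : 'rV[R]_n -> 'rV[R]_n -> R)
    (delta L mu tdelta : R) (x0 : 'rV[R]_n) (L0 : R)
    (x : nat -> 'rV[R]_n) (Ls : nat -> R) :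
  prox_function d ->
  convex_set Q -> compact Q ->
  convex_function Q f -> is_minimizer f Q xs ->
  0 < delta -> 0 < L -> 0 < mu ->
  (forall y, Q y -> is_model (bregman d) Q f psi delta L mu y) ->
  0 < tdelta -> Q x0 -> 2 * mu <= L0 <= 2 * L ->
  adaptive_gradient_run (bregman d) Q f psi xs mu delta tdelta x0 L0 x Ls ->
  forall (k : nat) (Lhat : R),
    1 - mu / Lhat
      = (\prod_(1 <= i < k.+2) (1 - mu / Ls i)) `^ (k.+1%:R^-1) ->
    bregman d (x k.+1) xs
      <= 2 * L * (delta + tdelta) / mu ^+ 2
           * (1 - (1 - mu / (2 * L)) ^+ k.+1)
         + (1 - mu / Lhat) ^+ k.+1 * bregman d x0 xs
    /\
    f (x k.+1) - f xs
      <= 4 * L ^+ 2 * (delta + tdelta) / mu ^+ 2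
           * (1 - (1 - mu / (2 * L)) ^+ k.+1)
         + 2 * L * (1 - mu / Lhat) ^+ k.+1 * bregman d x0 xs.
Proof.
move=> d_prox Qc _ _ [Qxs f_min] delta0 L_pos mu0 model tdelta0 Qx0
  /andP[muL0 L0L] [x0E L0E step] k Lhat.
have iter_mem j : Q (x j).
  by elim: j => [|j _]; [rewrite x0E | apply: adaptive_step_mem (step j)].
have const_bounds j : mu <= Ls j <= 2 * L.
  elim: j => [|j IHj]; first by rewrite L0E L0L andbT; lra.
  exact: adaptive_step_const_bounds d_prox (model _ (iter_mem j)) (step j) mu0
    IHj.
have descent j := adaptive_step_descent
  d_prox (model _ (iter_mem j)) (step j) Qc Qxs.
pose D := delta + tdelta; pose V j := bregman d (x j) xs.
have const_pos j : 0 < Ls j.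
  by case/andP: (const_bounds j) => muj _; exact: lt_le_trans muj.
pose W j := (1 - mu / Ls j.+1) * V j + D / Ls j.+1.
have WE j : Ls j.+1 * W j = (Ls j.+1 - mu) * V j + D.
  by rewrite /W; field; rewrite gt_eqF.
have V_le_W j : V j.+1 <= W j.
  rewrite -(ler_pM2l (const_pos j.+1)) WE.
  by have := descent j; have := f_min _ (iter_mem j.+1); rewrite /V /D; lra.
have gap_le_W j : f (x j.+1) - f xs <= Ls j.+1 * W j.
  have V0 : 0 <= V j.+1 by case: d_prox => _ dc dd _ _; exact: bregman_ge0.
  have : 0 <= Ls j.+1 * V j.+1 by rewrite mulr_ge0 // ltW.
  by rewrite WE; have := descent j; rewrite /V /D; lra.
have const_ge j : mu <= Ls j.+1 by case/andP: (const_bounds j.+1).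
set P := \prod_(1 <= i < k.+2) _; move=> LhatE.
have [/andP[P0 P1] W_le] :
    0 <= P <= 1 /\ W k <= P * V 0%N + D / mu * (1 - P).
  exact: contraction_unroll mu0 const_ge V_le_W k.
have {LhatE} -> : (1 - mu / Lhat) ^+ k.+1 = P.
  by rewrite LhatE -powR_mulrn ?powR_ge0 // -powRrM mulVf ?powRr1 // pnatr_eq0.
rewrite -x0E -/(V 0%N) -/(V k.+1) -/D.
pose E := 2 * L * D / mu ^+ 2 * (1 - (1 - mu / (2 * L)) ^+ k.+1).
have D0 : 0 < D by rewrite addr_gt0.
have L2 : 0 < 2 * L by rewrite mulr_gt0.
have err_le : D / mu * (1 - P) <= E.
  have r0 : 0 <= 1 - mu / (2 * L).
    by rewrite subr_ge0 ler_pdivrMr // mul1r; lra.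
  have r1 : 1 - mu / (2 * L) <= 1 by rewrite gerBl divr_ge0 ?ltW.
  have pow_le : (1 - mu / (2 * L)) ^+ k.+1 <= 1 - mu / (2 * L).
    by rewrite exprS ler_piMr // exprn_ile1.
  have -> : E = D / mu * ((2 * L) / mu * (1 - (1 - mu / (2 * L)) ^+ k.+1)).
    by rewrite /E; field; rewrite gt_eqF.
  (* The value 1 separates the two sides: it dominates [1 - P], and the
     right-hand side equals 1 when the exponent is 1. *)
  rewrite ler_pM2l ?divr_gt0 //; apply: (@le_trans _ _ 1); first lra.
  rewrite -ler_pdivrMl ?divr_gt0 // mulr1 invf_div.
  by lra.
have W_le_E : W k <= E + P * V 0%N by lra.
split; first exact: le_trans (V_le_W k) W_le_E.
have -> : 4 * L ^+ 2 * D / mu ^+ 2 * (1 - (1 - mu / (2 * L)) ^+ k.+1)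
    + 2 * L * P * V 0%N = 2 * L * (E + P * V 0%N).
  by rewrite /E; field; rewrite !gt_eqF.
have V0 : 0 <= V 0%N by case: d_prox => _ dc dd _ _; exact: bregman_ge0.
have bound0 : 0 <= E + P * V 0%N.
  apply: addr_ge0; last exact: mulr_ge0.
  apply: le_trans err_le.
  by rewrite mulr_ge0 ?subr_ge0 // divr_ge0 ?ltW.
apply: (le_trans (gap_le_W k)).
apply: (@le_trans _ _ (Ls k.+1 * (E + P * V 0%N))).
  by rewrite ler_pM2l.
by rewrite ler_wpM2r //; case/andP: (const_bounds k.+1).
Qed.
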